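(* Let $\mathcal{F}$ be a periodic tame frieze with minimal period $n$, let $(m_{i,j})_{i,j\in\mathbb{Z}}$ be its lattice, and let $(s_k)_{k\ge0}$ be its growth coefficients, $s_0:=2$ and $s_k:=m_{1,kn}-m_{2,kn-1}$ for $k\ge1$. Then (a) $s_{k+2}=s_1s_{k+1}-s_k$ for all $k\ge 0$; (b) for all $k\ge1$, $$s_k=s_1^k+k\sum_{l=1}^{\lfloor k/2\rfloor}(-1)^l\,\frac{1}{k-l}\binom{k-l}{l}\,s_1^{k-2l}.$$
   Context: A frieze is an array $\mathcal{F}=(m_{i,j})$ of real numbers, with $i\in\mathbb{Z}$, whose rows are the sets of positions with $j-i$ constant, such that $m_{i,i-2}=0$ and $m_{i,i-1}=1$ for all $i$, and such that $m_{i,j}m_{i+1,j+1}-m_{i,j+1}m_{i+1,j}=1$ whenever all four entries lie in the array. It is infinite if it is indexed by all $(i,j)$ with $j-i\ge -2$; it is finite if it is indexed by all $(i,j)$ with $-2\le j-i\le N-2$ for some integer $N\ge 3$ and ends with a row of ones followed by a row of zeros: $m_{i,i+N-3}=1$ and $m_{i,i+N-2}=0$ for all $i$. The frieze is tame if every $3\times 3$ matrix $\begin{pmatrix} m_{i,j}&m_{i+1,j}&m_{i+2,j}\\ m_{i,j+1}&m_{i+1,j+1}&m_{i+2,j+1}\\ m_{i,j+2}&m_{i+1,j+2}&m_{i+2,j+2}\end{pmatrix}$ of entries of the array has determinant $0$. It is $n$-periodic ($n\ge1$) if $m_{i+n,j+n}=m_{i,j}$ for all entries, and periodic if it is $n$-periodic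 for some $n\geq 1$; the minimal period is the least such $n$. The lattice $(m_{i,j})_{i,j\in\mathbb{Z}}$ of $\mathcal{F}$ is the extension of $\mathcal{F}$ to all of $\mathbb{Z}^2$ by anti-symmetric mirroring across rows of zeros: if $\mathcal{F}$ is infinite, $m_{i,j}=-m_{j+2,i-2}$ for $j-i<-2$; if $\mathcal{F}$ is finite, the lattice is the unique extension satisfying $m_{i,j}=-m_{j+2,i-2}$ and $m_{i,j}=-m_{j-N+2,i+N-2}$ for all $i,j\in\mathbb{Z}$. *)

(* Defs.v *)
From mathcomp Require Import all_boot all_order all_algebra reals.
From mathcomp Require Import zify.

Set Implicit Arguments.
Unset Strict Implicit.
Unset Printing Implicit Defensive.

Import Order.TTheory GRing.Theory Num.Theory.
Local Open Scope ring_scope.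

Inductive frieze_shape := Infinite | Finite of nat.

Definition in_array (w : frieze_shape) (i j : int) : bool :=
  match w with
  | Infinite => -2 <= j - i
  | Finite N => -2 <= j - i <= N%:Z - 2
  end.

(* An array of shape w is encoded as a total function F : int -> int -> R of
   which only the values at positions satisfying in_array w are meaningful:
   every predicate on F below constrains these entries only. *)

Definition is_frieze (R : realType) (w : frieze_shape) (F : int -> int -> R) : Prop :=
  [/\ forall i : int, F i (i - 2) = 0,
      forall i : int, F i (i - 1) = 1,
      forall i j : int,
        in_array w i j -> in_array w (i + 1) (j + 1) ->
        in_array w i (j + 1) -> in_array w (i + 1) j ->
        F i j * F (i + 1) (j + 1) - F i (j + 1) * F (i + 1) j = 1
    & match w with
      | Infinite => True
      | Finite N =>
          [/\ (3 <= N)%N,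
              forall i : int, F i (i + N%:Z - 3) = 1
            & forall i : int, F i (i + N%:Z - 2) = 0]
      end].

Definition is_tame (R : realType) (w : frieze_shape) (F : int -> int -> R) : Prop :=
  forall i j : int,
    (forall a b : 'I_3, in_array w (i + b%:Z) (j + a%:Z)) ->
    \det (\matrix_(a < 3, b < 3) F (i + b%:Z) (j + a%:Z)) = 0.

Definition is_period (R : realType) (w : frieze_shape) (F : int -> int -> R)
    (n : nat) : Prop :=
  (1 <= n)%N /\
  forall i j : int, in_array w i j -> F (i + n%:Z) (j + n%:Z) = F i j.

Definition is_minimal_period (R : realType) (w : frieze_shape) (F : int -> int -> R)
    (n : nat) : Prop :=
  is_period w F n /\ forall p : nat, is_period w F p -> (n <= p)%N.

Definition is_lattice (R : realType) (w : frieze_shape) (F m : int -> int -> R) :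
    Prop :=
  (forall i j : int, in_array w i j -> m i j = F i j) /\
  match w with
  | Infinite => forall i j : int, j - i < -2 -> m i j = - m (j + 2) (i - 2)
  | Finite N =>
      (forall i j : int, m i j = - m (j + 2) (i - 2)) /\
      (forall i j : int, m i j = - m (j - N%:Z + 2) (i + N%:Z - 2))
  end.

Lemma lattice_exists (R : realType) (w : frieze_shape) (F : int -> int -> R) :
  is_frieze w F -> exists m : int -> int -> R, is_lattice w F m.
Proof.
case: w => [|N] [F0 _ _ HN].
  exists (fun i j => if -2 <= j - i then F i j else - F (j + 2) (i - 2)).
  split=> [i j /= ->//|i j lt_ji].
  by rewrite leNgt lt_ji /= ifT //; lia.
case: HN => N3 _ FN.
have [q qP] : {q : int -> int -> int | forall i j (k : int),
    (q i j == k) = (0 <= j - i + 2 - (k * N%:Z) *+ 2 < N%:Z *+ 2)}.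
  exists (fun i j => ((j - i + 2) %/ (N%:Z *+ 2))%Z) => i j k.
  have N2 : 0 < N%:Z *+ 2 by lia.
  rewrite -mulrnAr; move: (j - i + 2) (N%:Z *+ 2) N2 => x y y0.
  apply/eqP/idP=> [<-|h].
    rewrite {1 3}(intdiv.divz_eq x y) addrC addKr.
    by rewrite intdiv.modz_ge0 ?intdiv.ltz_pmod ?gt_eqF.
  rewrite -[in LHS](subrK (k * y) x) addrC intdiv.divzMDl ?gt_eqF //.
  by rewrite intdiv.divz_small ?addr0 // gtz0_abs.
pose G (i j : int) := if j - i <= N%:Z - 2 then F i j
              else - F (j - N%:Z + 2) (i + N%:Z - 2).
pose m (i j : int) := G (i + q i j * N%:Z) (j - q i j * N%:Z).
have qE (i j k : int) : 0 <= j - i + 2 - (k * N%:Z) *+ 2 < N%:Z *+ 2 -> q i j = k.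
  by rewrite -qP => /eqP.
have qT (i j : int) : exists k : int, q i j = k /\
    0 <= j - i + 2 - (k * N%:Z) *+ 2 < N%:Z *+ 2.
  by exists (q i j); split=> //; rewrite -qP.
have mirror0 (i j : int) : m i j = - m (j + 2) (i - 2).
  have [k [kE hk]] := qT i j.
  have [d0|d0] := eqVneq (j - i + 2) ((k * N%:Z) *+ 2).
    have kE' : q (j + 2) (i - 2) = - k by apply: qE; rewrite mulNr; lia.
    rewrite /m kE kE' /G mulNr; move: (k * N%:Z) hk d0 => K hk d0.
    rewrite !ifT; try lia.
    have -> : j - K = i + K - 2 by lia.
    have -> : i - 2 - - K = j + 2 + - K - 2 by lia.
    by rewrite !F0 oppr0.
  have kE' : q (j + 2) (i - 2) = - k - 1.
    by apply: qE; rewrite mulrBl mulNr mul1r; lia.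
  rewrite /m kE kE' /G mulrBl mulNr mul1r.
  move: (k * N%:Z) hk d0 => K hk d0.
  have [dN|dN] := eqVneq (j - i + 2 - K *+ 2) N%:Z.
    rewrite !ifT; try lia.
    have -> : j - K = i + K + N%:Z - 2 by lia.
    have -> : i - 2 - (- K - N%:Z) = j + 2 + (- K - N%:Z) + N%:Z - 2 by lia.
    by rewrite !FN oppr0.
  case: ifPn => h; [rewrite ifF | rewrite ifT]; try lia.
    by rewrite opprK; congr (F _ _); lia.
  by congr (- F _ _); lia.
have trans (i j : int) : m (i - N%:Z) (j + N%:Z) = m i j.
  have [k [kE hk]] := qT i j.
  have kE' : q (i - N%:Z) (j + N%:Z) = k + 1.
    by apply: qE; rewrite mulrDl mul1r; lia.
  by rewrite /m kE kE' mulrDl mul1r; congr (G _ _); lia.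
exists m; split=> [i j /= hij|].
  have kE : q i j = 0 by apply: qE; rewrite mul0r; lia.
  by rewrite /m kE mul0r addr0 subr0 /G ifT //; lia.
split=> // i j; rewrite mirror0 -trans.
have -> : j + 2 - N%:Z = j - N%:Z + 2 by lia.
by have -> : i - 2 + N%:Z = i + N%:Z - 2 by lia.
Qed.

Lemma lattice_unique (R : realType) (w : frieze_shape) (F m m' : int -> int -> R) :
  is_frieze w F -> is_lattice w F m -> is_lattice w F m' ->
  forall i j : int, m i j = m' i j.
Proof.
case: w => [|N] [_ _ _ HN] [mF Hm] [mF' Hm'] i j.
  have mm' (a b : int) : -2 <= b - a -> m a b = m' a b.
    by move=> h; rewrite (mF a b h) (mF' a b h).
  have [h|h] := leP (-2) (j - i); first exact: mm'.
  by rewrite (Hm i j h) (Hm' i j h); congr (- _); apply: mm'; lia.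
case: HN => N3 _ _; case: Hm => [r0 rN]; case: Hm' => [r0' rN'].
have mm' (a b : int) : -2 <= b - a <= N%:Z - 2 -> m a b = m' a b.
  by move=> h; rewrite (mF a b h) (mF' a b h).
have half (k : nat) : forall a b : int, -2 <= b - a ->
    b - a <= k%:Z -> m a b = m' a b.
  elim/ltn_ind: k => k IH a b h1 h2.
  have [h|h] := leP (b - a) (N%:Z - 2); first by apply: mm'; lia.
  rewrite (rN a b) (rN' a b); congr (- _).
  have [g|g] := leP (-2) ((a + N%:Z - 2) - (b - N%:Z + 2)).
    by apply: (IH k.-1); lia.
  rewrite (r0 (b - N%:Z + 2)) (r0' (b - N%:Z + 2)); congr (- _).
  by apply: (IH k.-1); lia.
have [h|h] := leP (-2) (j - i).
  by apply: (half `|j - i|%N) => //; lia.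
by rewrite (r0 i j) (r0' i j); congr (- _); apply: (half `|i - j|%N); lia.
Qed.

(* growth_coeff m n k is s_k, for m the lattice of a frieze of minimal
   period n. *)
Definition growth_coeff (R : realType) (m : int -> int -> R) (n k : nat) : R :=
  if k is 0%N then 2 else m 1 (k * n)%N%:Z - m 2 ((k * n)%N%:Z - 1).

(* Main.v *)
Require Import Defs.
From mathcomp Require Import all_boot all_order all_algebra reals.
From mathcomp Require Import zify ring.
Import Order.TTheory GRing.Theory Num.Theory.
Local Open Scope ring_scope.

(* Tameness makes every row and column of the array a solution of the three-term
   recurrence whose coefficients are the entries m_{i,i}; for a finite frieze the
   glide symmetry of the array makes the lattice satisfy it as well. Hence s_k is
   the trace of the k-th power of a matrix of determinant 1, and (a) is
   Cayley-Hamilton. For (b), s_k = U_k - U_(k-2) with U_k the Chebyshev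
   polynomials of the second kind evaluated at s_1 / 2. *)

(** * Three-term recurrences in a tame array *)

Lemma det_mx33 (R : comNzRingType) (A : nat -> nat -> R) :
  \det (\matrix_(a < 3, b < 3) A a b) =
      A 0 0 * (A 1 1 * A 2 2 - A 1 2 * A 2 1)
    - A 0 1 * (A 1 0 * A 2 2 - A 1 2 * A 2 0)
    + A 0 2 * (A 1 0 * A 2 1 - A 1 1 * A 2 0).
Proof.
rewrite (expand_det_row _ ord0) !big_ord_recl big_ord0 /cofactor.
rewrite !(expand_det_row _ ord0) !big_ord_recl !big_ord0 /cofactor !det_mx11 !mxE.
rewrite /= /bump /=; ring.
Qed.

Lemma in_arrayW (w : frieze_shape) (i j i' j' : int) :
  in_array w i j -> -2 <= j' - i' <= j - i -> in_array w i' j'.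
Proof. by case: w => [|N] /=; lia. Qed.

(** [j - i] is largest at [(i, j + 1)] and smallest at [(i + 1, j)], so two bounds place all four
    entries in the array. *)
Lemma frieze_minor (R : realType) (w : frieze_shape) (F : int -> int -> R)
    (i j : int) :
  is_frieze w F -> in_array w i (j + 1) -> -1 <= j - i ->
  F i j * F (i + 1) (j + 1) - F i (j + 1) * F (i + 1) j = 1.
Proof.
case=> _ _ minorF _ ij h.
by apply: minorF; apply: in_arrayW ij _; lia.
Qed.

Lemma tame_det3 (R : realType) (w : frieze_shape) (F : int -> int -> R)
    (i j : int) :
  is_tame w F -> in_array w i (j + 2) -> 0 <= j - i ->
    F i j * (F (i + 1) (j + 1) * F (i + 2) (j + 2)
             - F (i + 2) (j + 1) * F (i + 1) (j + 2))
  - F (i + 1) j * (F i (j + 1) * F (i + 2) (j + 2)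
             - F (i + 2) (j + 1) * F i (j + 2))
  + F (i + 2) j * (F i (j + 1) * F (i + 1) (j + 2)
             - F (i + 1) (j + 1) * F i (j + 2)) = 0.
Proof.
move=> F_tame ij h; have := F_tame i j.
rewrite (det_mx33 _ (fun a b : nat => F (i + b%:Z) (j + a%:Z))) !addr0 => -> // a b.
by apply: in_arrayW ij _; have := ltn_ord a; have := ltn_ord b; lia.
Qed.

(* In a singular 3x3 block the relation between the rows holds in the last two
   columns by induction; as their minor on the upper rows is 1, it holds in the
   first column. *)
Lemma frieze_row_rec (R : realType) (w : frieze_shape) (F : int -> int -> R)
    (i j : int) :
  is_frieze w F -> is_tame w F -> in_array w i j -> 0 <= j - i ->
  F i j = F j j * F i (j - 1) - F i (j - 2).
Proof.
move=> F_frieze F_tame.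
have [F0 F1 _ _] := F_frieze.
move=> ij h; have [d dE] : exists d : nat, i = j - d%:Z by exists `|j - i|%N; lia.
rewrite {i h}dE in ij *; elim/ltn_ind: d ij => -[|[|d]] IH ij.
- by rewrite subr0 F0 F1; ring.
- have := @frieze_minor _ _ _ (j - 1) (j - 1) F_frieze.
  rewrite !subrK F1 => /(_ ij) minor1.
  have -> : j - 2 = (j - 1) - 1 by lia.
  rewrite F1; rewrite -minor1; [ring | lia].
have e1 : j - d.+2%:Z + 1 = j - d.+1%:Z by lia.
have e2 : j - d.+2%:Z + 2 = j - d%:Z by lia.
have h1 := IH d.+1 (ltnSn _) ltac:(by apply: in_arrayW ij _; lia).
have h2 := IH d (ltnW (ltnSn _)) ltac:(by apply: in_arrayW ij _; lia).
have := @frieze_minor _ _ _ (j - d.+1%:Z) (j - 2) F_frieze.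
have := @tame_det3 _ _ _ (j - d.+2%:Z) (j - 2) F_tame.
have -> : j - d.+1%:Z + 1 = j - d%:Z by lia.
have -> : j - 2 + 1 = j - 1 by lia.
rewrite e1 e2 subrK h1 h2 => /(_ ij ltac:(lia)) det0.
move=> /(_ ltac:(by apply: in_arrayW ij _; lia) ltac:(lia)) minor1.
(* The difference of the two sides, times the minor 1, is the determinant of the block. *)
apply/eqP; rewrite -subr_eq0 -[X in X == _]mulr1 -minor1 -det0; apply/eqP; ring.
Qed.

(** The transposed argument: by induction the relation between the columns of the block holds in its
    first two rows, whose minor in the last two columns is 1; this forces it in the third row. *)
Lemma frieze_col_rec (R : realType) (w : frieze_shape) (F : int -> int -> R)
    (i j : int) :
  is_frieze w F -> is_tame w F -> in_array w i j -> 0 <= j - i ->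
  F i j = F i i * F (i + 1) j - F (i + 2) j.
Proof.
move=> F_frieze F_tame.
have [F0 F1 _ _] := F_frieze.
move=> ij h; have [d dE] : exists d : nat, j = i + d%:Z by exists `|j - i|%N; lia.
rewrite {j h}dE in ij *; elim/ltn_ind: d ij => -[|[|d]] IH ij.
- rewrite addr0; have := F1 (i + 1); have := F0 (i + 2).
  by rewrite !addrK => -> ->; ring.
- have := @frieze_minor _ _ _ i i F_frieze ij.
  have := F1 (i + 2); have := F1 (i + 1).
  have -> : i + 2 - 1 = i + 1 by lia.
  by rewrite addrK => -> -> minor1; rewrite -minor1; [ring | lia].
have e2 : i + d%:Z + 2 = i + d.+2%:Z by lia.
have e3 : i + d%:Z + 1 = i + d.+1%:Z by lia.
have h1 := IH d.+1 (ltnSn _) ltac:(by apply: in_arrayW ij _; lia).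
have h2 := IH d (ltnW (ltnSn _)) ltac:(by apply: in_arrayW ij _; lia).
have := @frieze_minor _ _ _ (i + 1) (i + d%:Z) F_frieze.
have := @tame_det3 _ _ _ i (i + d%:Z) F_tame.
have -> : i + 1 + 1 = i + 2 by lia.
rewrite e2 e3 h1 h2 => /(_ ij ltac:(lia)) det0.
move=> /(_ ltac:(by apply: in_arrayW ij _; lia) ltac:(lia)) minor1.
apply/eqP; rewrite -subr_eq0 -[X in X == _]mulr1 -minor1 -det0; apply/eqP; ring.
Qed.

(** * Glide symmetry of finite friezes *)

(** As [j] grows, the left side follows the row recurrence and the right side the column recurrence,
    both with coefficient [F j j]; by the border rows both start with 0 and 1. *)
Lemma finite_frieze_glide (R : realType) (N : nat) (F : int -> int -> R) (i j : int) :
  is_frieze (Defs.Finite N) F -> is_tame (Defs.Finite N) F -> in_array (Defs.Finite N) i j ->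
  F i j = F (j + 2) (i + N%:Z - 2).
Proof.
move=> F_frieze F_tame.
have [F0 F1 _ [N3 FN1 FN0]] := F_frieze.
move=> ij; have [d dE] : exists d : nat, j = i - 2 + d%:Z.
  by exists `|(j - i + 2)%R|%N; move: ij => /=; lia.
rewrite {j}dE in ij *; elim/ltn_ind: d ij => -[|[|d]] IH ij.
- by rewrite addr0 F0 subrK FN0.
- have -> : i - 2 + 1 = i - 1 by lia.
  have -> : i - 1 + 2 = i + 1 by lia.
  have -> : i + N%:Z - 2 = i + 1 + N%:Z - 3 by lia.
  by rewrite F1 FN1.
have e1 : i - 2 + d.+2%:Z = i + d%:Z by lia.
rewrite e1 in ij *; rewrite /= in ij.
rewrite (frieze_row_rec _ _ _ _ _ F_frieze F_tame) /=; try lia.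
have -> : i + d%:Z - 1 = i - 2 + d.+1%:Z by lia.
have -> : i + d%:Z - 2 = i - 2 + d%:Z by lia.
rewrite (IH d.+1) ?(IH d) /=; try lia.
have -> : i - 2 + d.+1%:Z + 2 = i + d%:Z + 1 by lia.
have -> : i - 2 + d%:Z + 2 = i + d%:Z by lia.
rewrite [in F (i + d%:Z) (i + _ - 2)](frieze_col_rec _ _ _ _ _ F_frieze F_tame) /=; try lia.
ring.
Qed.

(** * Continuants along the lattice *)

(** For [t > 0], over a commutative ring, this is the determinant of the tridiagonal matrix of size
    [t - 1] with diagonal [a i], ..., [a (i + t - 2)] and ones beside it. The shift puts [t = 0] on
    the row of zeros. *)
Fixpoint continuant (R : pzRingType) (a : int -> R) (i : int) (t : nat) : R :=
  match t with
  | 0%N => 0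
  | 1%N => 1
  | (t'.+1 as t1).+1 => a (i + t'%:Z) * continuant R a i t1 - continuant R a i t'
  end.

Arguments continuant {R} a i t : simpl never.

Lemma continuantSS (R : pzRingType) (a : int -> R) (i : int) (t : nat) :
  continuant a i t.+2 = a (i + t%:Z) * continuant a i t.+1 - continuant a i t.
Proof. by []. Qed.

Lemma linear_rec2_eq (R : pzRingType) (a u v : nat -> R) :
  (forall t, u t.+2 = a t * u t.+1 - u t) ->
  (forall t, v t.+2 = a t * v t.+1 - v t) ->
  u 0%N = v 0%N -> u 1%N = v 1%N -> u =1 v.
Proof.
move=> uR vR e0 e1 t; suff [] : u t = v t /\ u t.+1 = v t.+1 by [].
by elim: t => // t [IH1 IH2]; split=> //; rewrite uR vR IH1 IH2.
Qed.

Lemma frieze_continuant (R : realType) (w : frieze_shape) (F : int -> int -> R)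
    (i : int) (t : nat) :
  is_frieze w F -> is_tame w F -> in_array w i (i - 2 + t%:Z) ->
  F i (i - 2 + t%:Z) = continuant (fun j => F j j) i t.
Proof.
move=> F_frieze F_tame; have [F0 F1 _ _] := F_frieze.
elim/ltn_ind: t => -[|[|t]] IH it.
- by rewrite addr0 F0.
- by rewrite (_ : i - 2 + 1 = i - 1) ?F1 //; lia.
rewrite continuantSS -!IH //; try by apply: in_arrayW it _; lia.
rewrite (frieze_row_rec _ _ _ _ _ F_frieze F_tame) //; last by lia.
by congr (F _ _ * F _ _ - F _ _); lia.
Qed.

(** Two glides compose to the translation by [(N, N)]. *)
Lemma finite_frieze_quiddity (R : realType) (N : nat) (F : int -> int -> R) (i : int) :
  is_frieze (Defs.Finite N) F -> is_tame (Defs.Finite N) F ->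
  F (i + N%:Z) (i + N%:Z) = F i i.
Proof.
move=> F_frieze F_tame; have [_ _ _ [N3 _ _]] := F_frieze.
rewrite (finite_frieze_glide _ _ _ i i F_frieze F_tame) /=; last by lia.
rewrite (finite_frieze_glide _ _ _ (i + 2) _ F_frieze F_tame) /=; last by lia.
by congr (F _ _); lia.
Qed.

(** Both sides solve the same recurrence, its coefficients being [N]-periodic. The closing rows give
    [c N.-1 = 1] and [c N = 0], hence [c N.+1 = -1]. *)
Lemma finite_frieze_continuantDN (R : realType) (N : nat) (F : int -> int -> R)
    (i : int) (t : nat) :
  is_frieze (Defs.Finite N) F -> is_tame (Defs.Finite N) F ->
  let c := continuant (fun j => F j j) i in c (t + N)%N = - c t.
Proof.
move=> F_frieze F_tame c; have [_ _ _ [N3 FN1 FN0]] := F_frieze.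
have cN : c N = 0.
  rewrite /c -(frieze_continuant _ _ _ _ _ F_frieze F_tame) /=; last by lia.
  by rewrite -(FN0 i); congr (F _ _); lia.
have cN1 : c N.-1 = 1.
  rewrite /c -(frieze_continuant _ _ _ _ _ F_frieze F_tame) /=; last by lia.
  by rewrite -(FN1 i); congr (F _ _); lia.
apply: (linear_rec2_eq _ (fun t => F (i + t%:Z) (i + t%:Z))
          (fun t => c (t + N)%N) (fun t => - c t)) => [{}t|{}t||] /=.
- rewrite !addSn /c continuantSS -(finite_frieze_quiddity _ _ _ (i + t%:Z) F_frieze F_tame).
  by congr (F _ _ * _ - _); lia.
- by rewrite /c continuantSS; ring.
- by rewrite add0n cN oppr0.
have := continuantSS _ (fun j => F j j) i N.-1.
rewrite -/c prednK; last by lia.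
by rewrite add1n cN cN1 => ->; rewrite /c /continuant; ring.
Qed.

(** In the finite case, one glide settles [N < t <= 2N]. Beyond, the two mirrorings compose to
    [(i, j) -> (i + N, j - N)], which lowers [t] by [2N]; the shift of [i] is harmless as the
    coefficients are [N]-periodic. *)
Lemma lattice_continuant (R : realType) (w : frieze_shape) (F m : int -> int -> R)
    (i : int) (t : nat) :
  is_frieze w F -> is_tame w F -> is_lattice w F m ->
  m i (i - 2 + t%:Z) = continuant (fun j => F j j) i t.
Proof.
case: w => [|N] F_frieze F_tame [mF].
  by rewrite mF ?(frieze_continuant _ _ _ _ _ F_frieze F_tame) //=; lia.
have [_ _ _ [N3 _ _]] := F_frieze.
case=> mirror0 mirrorN; elim/ltn_ind: t i => t IH i.
have [tN|Nt] := leqP t N.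
  by rewrite mF ?(frieze_continuant _ _ _ _ _ F_frieze F_tame) //=; lia.
have [u tE] : exists u, t = (u + N)%N by exists (t - N)%N; lia.
rewrite tE finite_frieze_continuantDN // mirrorN.
have [uN|Nu] := leqP u N.
  rewrite -(frieze_continuant _ _ _ _ _ F_frieze F_tame) /=; last by lia.
  rewrite (finite_frieze_glide _ _ _ _ _ F_frieze F_tame) /=; last by lia.
  rewrite mF /=; last by lia.
  by congr (- F _ _); lia.
have [v uE] : exists v, u = (v + N)%N by exists (u - N)%N; lia.
have cT : continuant (fun j => F j j) i v = continuant (fun j => F j j) (i + N%:Z) v.
  move: v {uE}; apply: (linear_rec2_eq _ (fun t => F (i + t%:Z) (i + t%:Z))) => // v.
  rewrite continuantSS -(finite_frieze_quiddity _ _ _ (i + v%:Z) F_frieze F_tame).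
  by congr (F _ _ * _ - _); lia.
rewrite mirror0 uE finite_frieze_continuantDN // !opprK cT -IH; last by lia.
by congr (m _ _); lia.
Qed.

(** * The trace recurrence *)

(* With p = continuant a i and q t = continuant a (i + 1) (t - 1), the monodromy
   matrix (p_(n+1), - q_(n+1); p_n, - q_n) has determinant 1 and trace s below;
   the recurrence is its Cayley-Hamilton identity. *)
Lemma periodic_rec2_trace (R : comPzRingType) (a p q : nat -> R) (n : nat) :
  (forall t, p t.+2 = a t * p t.+1 - p t) ->
  (forall t, q t.+2 = a t * q t.+1 - q t) ->
  p 0%N = 0 -> p 1%N = 1 -> q 0%N = -1 -> q 1%N = 0 ->
  (forall t, a (t + n)%N = a t) ->
  let s k := p (k * n).+1 - q (k * n)%N in
  forall k, s k.+2 = s 1%N * s k.+1 - s k.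
Proof.
move=> pR qR p0 p1 q0 q1 a_per s.
have det1 t : p t * q t.+1 - p t.+1 * q t = 1.
  elim: t => [|t IH]; first by rewrite p0 p1 q0 q1; ring.
  by rewrite pR qR -IH; ring.
(* By periodicity a shifted solution is again a solution, hence the combination of [p] and [q] fixed
   by its first two values. *)
have shift (u : nat -> R) : (forall t, u t.+2 = a t * u t.+1 - u t) ->
    forall t, u (t + n)%N = u n.+1 * p t - u n * q t.
  move=> uR; apply: (linear_rec2_eq _ a (fun t => u (t + n)%N)) => [t|t||].
  - by rewrite !addSn uR a_per.
  - by rewrite pR qR; ring.
  - by rewrite add0n p0 q0; ring.
  by rewrite add1n p1 q1; ring.
(* Cayley-Hamilton on solutions: [det1 n] makes the coefficient of [u t] equal to 1. *)
have shift2 (u : nat -> R) : (u = p \/ u = q) ->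
    forall t, u (t + n + n)%N = s 1%N * u (t + n)%N - u t.
  by case=> -> t; rewrite !(shift p, shift q) // /s !mul1n
    -[X in _ = _ - X]mul1r -(det1 n); ring.
move=> k; rewrite /s -/(s 1%N) !mulSn.
have -> : (n + (n + k * n) = k * n + n + n)%N by lia.
have -> : (n + k * n = k * n + n)%N by lia.
rewrite -!addSn !shift2; [ring | by right | by left].
Qed.

(** * Chebyshev polynomials and the closed form *)

(* The Chebyshev polynomial of the second kind U_k, at x / 2. *)
Definition chebyshevU (R : pzRingType) (x : R) (k : nat) : R :=
  \sum_(l < k.+1) (-1) ^+ l * 'C(k - l, l)%:R * x ^+ (k - 2 * l)%N.

(** Pascal's rule splits the term of index [l + 1] into that of [x * U_(k+1)] and minus the term of
    index [l] of [U_k]. *)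
Lemma chebyshevUSS (R : comPzRingType) (x : R) (k : nat) :
  chebyshevU _ x k.+2 = x * chebyshevU _ x k.+1 - chebyshevU _ x k.
Proof.
rewrite /chebyshevU big_ord_recr big_ord_recl [in X in x * X]big_ord_recl /=.
rewrite subnn bin0n mulr0 mul0r addr0 !subn0 !bin0 mulrDr -addrA.
congr (_ + _); first by rewrite exprS; ring.
rewrite mulr_sumr -sumrB; apply: eq_bigr => l _; rewrite /bump /= !add1n.
have lk := ltn_ord l.
have -> : (k.+2 - l.+1 = (k - l).+1)%N by lia.
have -> : (k.+1 - l.+1 = k - l)%N by lia.
have -> : (k.+2 - 2 * l.+1 = k - 2 * l)%N by lia.
rewrite binS natrD exprS.
(* For [k <= 2 * l] the truncated exponents do not match, but the binomial coefficient vanishes. *)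
have [lk2|kl2] := ltnP (2 * l) k;
  last by rewrite (@bin_small (k - l) l.+1); [ring | lia].
have -> : (k - 2 * l = (k.+1 - 2 * l.+1).+1)%N by lia.
by rewrite exprS; ring.
Qed.

(** Termwise, with [c = k - l + 1]: ['C(c - 1, l)] is [(l + 1) / c] times ['C(c, l + 1)], and
    [c + (l + 1) = k + 2]. *)
Lemma chebyshevUB (R : numFieldType) (x : R) (k : nat) :
  chebyshevU _ x k.+2 - chebyshevU _ x k =
  x ^+ k.+2 + k.+2%:R * \sum_(1 <= l < (k.+2 %/ 2).+1%N)
     (-1) ^+ l * (1 / (k.+2 - l)%N%:R) * 'C(k.+2 - l, l)%:R * x ^+ (k.+2 - 2 * l)%N.
Proof.
pose f l := (-1) ^+ l * (1 / (k.+2 - l)%N%:R) * 'C(k.+2 - l, l)%:R * x ^+ (k.+2 - 2 * l)%N.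
(* The added terms have zero binomials; the sum now has the index range of [U_k], shifted by one. *)
have -> : \sum_(1 <= l < (k.+2 %/ 2).+1%N) f l = \sum_(1 <= l < k.+2) f l.
  rewrite [RHS](big_cat_nat _ (n := (k.+2 %/ 2).+1)) //=; last by lia.
  rewrite [X in _ + X]big_nat_cond [X in _ + X]big1 ?addr0 // => l h.
  by rewrite /f bin_small ?mulr0 ?mul0r //; lia.
rewrite big_add1 big_mkord /chebyshevU big_ord_recr big_ord_recl /=.
rewrite subnn bin0n mulr0 mul0r addr0 !subn0 !bin0 -addrA.
congr (_ + _); first by ring.
rewrite mulr_sumr -sumrB; apply: eq_bigr => l _; rewrite /f /bump /= !add1n.
have lk := ltn_ord l.
have -> : (k.+2 - l.+1 = (k - l).+1)%N by lia.
have -> : (k.+2 - 2 * l.+1 = k - 2 * l)%N by lia.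
have kE : k.+2%:R = (k - l).+1%:R + l.+1%:R :> R by rewrite -natrD; congr _%:R; lia.
have := congr1 (fun j => j%:R : R) (mul_bin_diag (k - l).+1 l).
rewrite /= !natrM => diag.
have nz : (k - l).+1%:R != 0 :> R by rewrite pnatr_eq0.
have -> : 'C(k - l, l)%:R = l.+1%:R * 'C((k - l).+1, l.+1)%:R / (k - l).+1%:R :> R.
  by rewrite -diag mulrC mulKf.
rewrite kE; move: (k - l).+1%:R nz => c nz.
by rewrite exprS; field.
Qed.

Theorem proposition2p10 (R : realType) (w : frieze_shape) (F m : int -> int -> R)
    (n : nat) (F_frieze : is_frieze w F) (F_tame : is_tame w F)
    (F_period : is_minimal_period w F n) (m_lattice : is_lattice w F m) :
  let s : nat -> R := growth_coeff m n in
  (forall k : nat, s k.+2 = s 1%N * s k.+1 - s k) /\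
  (forall k : nat, (1 <= k)%N ->
     s k = s 1%N ^+ k
           + k%:R * \sum_(1 <= l < (k %/ 2).+1%N)
               (-1) ^+ l * (1 / (k - l)%N%:R) * 'C(k - l, l)%:R
               * s 1%N ^+ (k - 2 * l)%N).
Proof.
case: F_period => -[n0 F_per] _ s.
pose a (j : int) := F j j.
pose p t := continuant a 1 t.
(* The value -1 extends the recurrence one step back: it solves [q 2 = a 1 * q 1 - q 0] with
   [q 1 = 0] and [q 2 = 1]. It also yields [s 0 = 2]. *)
pose q t := if t is t'.+1 then continuant a 2 t' else -1.
have sE k : s k = p (k * n).+1 - q (k * n)%N.
  case: k => [|k]; first by rewrite mul0n /p /q /= /continuant; ring.
  rewrite /s /growth_coeff.
  have [t tE] : exists t, (k.+1 * n = t.+1)%N by exists (k.+1 * n).-1; lia.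
  rewrite tE /q /p /a.
  rewrite -!(lattice_continuant _ _ _ _ _ _ F_frieze F_tame m_lattice).
  by congr (m _ _ - m _ _); lia.
have sR k : s k.+2 = s 1%N * s k.+1 - s k.
  rewrite !sE; apply: (periodic_rec2_trace _ (fun t => a (1 + t%:Z)) p q) => //.
  - by case=> [|t]; rewrite /q /= ?continuantSS /continuant; [ring | congr (a _ * _ - _); lia].
  move=> t; rewrite /a -(F_per (1 + t%:Z) (1 + t%:Z)).
    by rewrite PoszD addrA.
  by case: w F_frieze {F_tame m_lattice F_per} => [|N] [_ _ _ /=]; [lia | case; lia].
split=> // k.
have s0 : s 0%N = 2 by [].
have U0 : chebyshevU _ (s 1%N) 0 = 1 by rewrite /chebyshevU big_ord1 bin0 !expr0 !mulr1.
have U1 : chebyshevU _ (s 1%N) 1 = s 1%N.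
  by rewrite /chebyshevU big_ord_recr big_ord1 /= bin0 (@bin_small (1 - 1) 1) //; ring.
have sU : forall j, s j.+2 = chebyshevU _ (s 1%N) j.+2 - chebyshevU _ (s 1%N) j.
  apply: (linear_rec2_eq _ (fun=> s 1%N) (fun j => s j.+2)) => [t|t||].
  - by rewrite sR.
  - by rewrite !chebyshevUSS; ring.
  - by rewrite sR chebyshevUSS U0 U1 s0; ring.
  by rewrite !sR !chebyshevUSS U0 U1 s0; ring.
(* The difference formula starts at [k = 2]; for [k = 1] the sum is empty. *)
case: k => [|[|k]] // _.
  by rewrite big_geq // mulr0 addr0.
by rewrite sU; apply: chebyshevUB.
Qed.
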